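(* Let $X$ be a locally compact, connected, locally connected Hausdorff space and let $\mu$ be a compact-finite topological measure on $X$. Then the restriction $\lambda$ of $\mu$ to $\mathscr{A}_s^*(X)$ is a solid-set function, and $\mu$ is uniquely determined by $\lambda$ (that is, any compact-finite topological measure on $X$ whose restriction to $\mathscr{A}_s^*(X)$ is $\lambda$ equals $\mu$).
   Context: All spaces are Hausdorff (compact spaces are included among the locally compact ones). $\mathscr{O}(X)$, $\mathscr{C}(X)$, $\mathscr{K}(X)$ denote the open, closed, compact subsets of $X$. A set is bounded if its closure is compact. ''Component'' means connected component. The empty set is regarded as connected. $\bigsqcup$ (or $\sqcup$) denotes a union of disjoint sets. Solid sets: if $X$ is noncompact, $A\subseteq X$ is solid if $A$ is connected and every component of $X\setminus A$ is unbounded; if $X$ is compact, $A$ is solid if $A$ and $X\setminus A$ are connected. $\mathscr{K}_s(X)$ is the family of compact solid sets, $\mathscr{O}_s^*(X)$ the family of bounded open solid sets, and $\mathscr{A}_s^*(X)=\mathscr{K}_s(X)\cup\mathscr{O}_s^*(X)$. A solid-set function on $X$ is a function $\lambda:\mathscr{A}_s^*(X)\to[0,\infty)$ such that: (s1) $\sum_{i=1}^n\lambda(C_i)\le\lambda(C)$ whenever $\bigsqcup_{i=1}^n C_i\subseteq C$ with $C,C_i\in\mathscr{K}_s(X)$; (s2) $\lambda(U)=\sup\{\lambda(K):K\subseteq U,\ K\in\mathscr{K}_s(X)\}$ for $U\in\mathscr{O}_s^*(X)$; (s3) $\lambda(K)=\inf\{\lambda(U):K\subseteq U,\ U\in\mathscr{O}_s^*(X)\}$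 for $K\in\mathscr{K}_s(X)$; (s4) $\lambda(A)=\sum_{i=1}^n\lambda(A_i)$ whenever $A=\bigsqcup_{i=1}^n A_i$ with $A,A_i\in\mathscr{A}_s^*(X)$. A topological measure on $X$ is a set function $\mu:\mathscr{C}(X)\cup\mathscr{O}(X)\to[0,\infty]$, not identically $\infty$, such that: (TM1) $\mu(A\sqcup B)=\mu(A)+\mu(B)$ whenever $A,B,A\sqcup B\in\mathscr{K}(X)\cup\mathscr{O}(X)$; (TM2) $\mu(U)=\sup\{\mu(K):K\in\mathscr{K}(X),K\subseteq U\}$ for $U\in\mathscr{O}(X)$; (TM3) $\mu(F)=\inf\{\mu(U):U\in\mathscr{O}(X),F\subseteq U\}$ for $F\in\mathscr{C}(X)$. It is compact-finite if $\mu(K)<\infty$ for every compact $K$. *)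

(* Defs.v *)
From HB Require Import structures.
From mathcomp Require Import all_boot all_order all_algebra.
From mathcomp Require Import all_classical reals ereal topology.

Set Implicit Arguments.
Unset Strict Implicit.
Unset Printing Implicit Defensive.

Local Open Scope classical_set_scope.

Section Topology.
Context {X : topologicalType}.
Implicit Types A : set X.

Definition locally_connected_space :=
  forall (x : X) (U : set X), nbhs x U ->
    exists V : set X, [/\ open V, V x, connected V & V `<=` U].

Definition has_compact_closure A := compact (closure A).

(* The connected components of a set B are the sets
   [connected_component B x] with x in B. *)
Definition solid A :=
  [/\ connected A,
      ~ compact [set: X] -> forall x, (~` A) x ->
        ~ has_compact_closure (connected_component (~` A) x) &
      compact [set: X] -> connected (~` A)].

Definition compact_solid : set (set X) :=
  [set A | compact A /\ solid A].

Definition bounded_open_solid : set (set X) :=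
  [set A | [/\ open A, has_compact_closure A & solid A]].

Definition bounded_solid : set (set X) :=
  compact_solid `|` bounded_open_solid.

End Topology.

Arguments locally_connected_space : clear implicits.

(* A set function defined on a family of subsets of X is represented by a total
   function on [set X]; the definitions below only use its values on that
   family. *)
Section SetFunctions.
Context {R : realType} {X : topologicalType}.
Local Open Scope ereal_scope.

(* Domain: [bounded_solid]; values in [0, +oo[, seen inside \bar R. *)
Record solid_set_function (lam : set X -> \bar R) : Prop := SolidSetFunction {
  ssf_ge0 : forall A, bounded_solid A -> 0 <= lam A;
  ssf_fin : forall A, bounded_solid A -> lam A < +oo;
  ssf_superadditive : forall (n : nat) (Ci : 'I_n -> set X) (C : set X),
    (forall i, compact_solid (Ci i)) -> compact_solid C ->
    trivIset [set: 'I_n] Ci -> \bigcup_i Ci i `<=` C ->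
    \sum_(i < n) lam (Ci i) <= lam C;
  ssf_inner : forall U, bounded_open_solid U ->
    lam U = ereal_sup [set lam K | K in [set K | compact_solid K /\ K `<=` U]];
  ssf_outer : forall K, compact_solid K ->
    lam K =
      ereal_inf [set lam U | U in [set U | bounded_open_solid U /\ K `<=` U]];
  ssf_additive : forall (n : nat) (Ai : 'I_n -> set X) (A : set X),
    (forall i, bounded_solid (Ai i)) -> bounded_solid A ->
    trivIset [set: 'I_n] Ai -> A = \bigcup_i Ai i ->
    lam A = \sum_(i < n) lam (Ai i)
}.

(* Domain: the sets that are closed or open; values in [0, +oo]. *)
Record topological_measure (mu : set X -> \bar R) : Prop := TopologicalMeasure {
  tm_ge0 : forall A, closed A \/ open A -> 0 <= mu A;
  tm_proper : exists A, (closed A \/ open A) /\ mu A <> +oo;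
  tm_additive : forall A B,
    compact A \/ open A -> compact B \/ open B ->
    compact (A `|` B) \/ open (A `|` B) -> A `&` B = set0 ->
    mu (A `|` B) = mu A + mu B;
  tm_inner : forall U, open U ->
    mu U = ereal_sup [set mu K | K in [set K | compact K /\ K `<=` U]];
  tm_outer : forall F, closed F ->
    mu F = ereal_inf [set mu U | U in [set U | open U /\ F `<=` U]]
}.

Definition compact_finite (mu : set X -> \bar R) :=
  forall K, compact K -> mu K < +oo.

End SetFunctions.

(* Main.v *)
Require Import Defs.
From mathcomp Require Import all_boot all_order all_algebra.
From mathcomp Require Import all_classical reals ereal topology.

(** Why the theorem holds.

    Finiteness, [ssf_superadditive] and [ssf_additive] only use that a topological measure is
    monotone and finitely additive.  In [ssf_additive] the pieces may mix compact and open
    sets, so that a partial union can be neither; the compact pieces are therefore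
    merged into one compact set and the open ones into one open set, and
    additivity is applied once to these two ([tm_bigcup]).

    The axioms [ssf_inner] and [ssf_outer] compare a supremum over compact solid sets with one over
    all compact sets, and an infimum over bounded open solid sets with one over
    all open sets.  They hold because solid sets interpolate: between a compact
    set and a bounded open solid set around it lies a compact solid set
    ([compact_solid_between]), and between a compact solid set and an open set
    around it lies a bounded open solid set ([open_solid_between]).  Both rest on
    one connecting device, [compact_connected_traces]: inside an open set, a
    compact set can be enlarged to a compact set that meets each component in a
    connected set.  For the first interpolation one connects the compact set and
    then fills its holes.  For the second one applies the device to the boundary
    of a neighbourhood of the compact solid set K, inside the complement of K: the
    enlarged boundary F has a connected part in each component of the complement
    of K, and the component of the complement of F that contains K is solid.

    For uniqueness, a compact connected set C is completed to its solid hull by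
    its bounded complementary components.  The hull is compact and solid, and each
    of these components is open, bounded and solid
    ([compact_solid_of_hull], [bounded_open_solid_component]).  So the values on
    solid sets give the measure of the hull and of each hole; a compact subset of
    the union of the holes meets only finitely many of them, hence they also give the measure of the union of the
    holes ([tm_le_open_of_components]) and, by subtraction, that of C
    ([tm_eq_compact_connected]).  Compact connected sets are cofinal among the
    compact subsets of a connected open set, so the measures of connected open
    sets, of all open sets, and finally of all closed sets are determined. *)

Set Implicit Arguments.
Unset Strict Implicit.
Unset Printing Implicit Defensive.

Import Order.TTheory.

Local Open Scope classical_set_scope.

(** * Compactness and connectedness *)

Section GeneralTopology.
Context {X : topologicalType}.
Implicit Types (A B C K N O Q S U V W : set X).

(** Induction on compact sets: a property of sets that passes to subsets and to
    finite unions holds for Q once it holds near each point of Q.  If it failed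
    for Q, the sets S such that it holds for Q minus S would form a proper filter
    containing Q, and a cluster point of this filter would contradict locality. *)
Lemma compact_local_ind (P : set X -> Prop) Q :
  P set0 -> (forall A B, P A -> P B -> P (A `|` B)) ->
  (forall A B, A `<=` B -> P B -> P A) ->
  compact Q -> (forall x, Q x -> exists2 N, nbhs x N & P N) -> P Q.
Proof.
move=> P0 PU Psub cQ Ploc; apply: contrapT => nPQ.
pose F : set_system X := [set S | P (Q `\` S)].
have PF : ProperFilter F.
  split; last split.
  - by rewrite /F /= setD0.
  - by rewrite /F /= setDT.
  - by move=> S S' FS FS'; rewrite /F /= setDIr; exact: PU.
  - by move=> S S' SS' FS; apply: Psub FS; exact: setDS.
have FQ : F Q by rewrite /F /= setDv.
have [x [Qx clx]] := cQ F PF FQ.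
have [N Nx PN] := Ploc x Qx.
have FN : F (~` N) by apply: Psub PN => y [_ /contrapT].
by have [y []] := clx _ _ FN Nx.
Qed.

(** Every point of S is tied to C inside S, so S is a single component; if C is
    empty, so is S. *)
Lemma connected_star C S :
  connected C -> C `<=` S ->
  (forall x, S x -> exists T, [/\ T x, T `<=` S, connected T & T `&` C !=set0]) ->
  connected S.
Proof.
move=> cC CS star; have [->|/set0P[s Ss]] := eqVneq S set0.
  exact: connected0.
have [_ [_ _ _ [c [_ Cc]]]] := star s Ss.
suff -> : S = connected_component S c by exact: component_connected.
apply/seteqP; split; last exact: connected_component_sub.
move=> x Sx; have [T [Tx TS cT [t [Tt Ct]]]] := star x Sx.
apply: (@connected_component_trans _ _ t); first by exists C.
by exists T.
Qed.

Lemma connected_avoiding_boundary A W : open W -> connected A ->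
  A `&` (closure W `\` W) = set0 -> A `<=` W \/ A `<=` ~` closure W.
Proof.
move=> oW cA AdW; apply: connected_subset cA.
  split; first by apply/disjoints_subset; rewrite setCK.
  apply/disjoints_subset => z Wz clz.
  have [w [nclw Ww]] := clz _ (open_nbhs_nbhs (conj oW Wz)).
  exact/nclw/subset_closure.
move=> x Ax; have [clx|] := pselect (closure W x); last by right.
left; apply: contrapT => nWx.
by have : (A `&` (closure W `\` W)) x by []; rewrite AdW.
Qed.

Lemma component_eq_of_meet A x y z :
  connected_component A x z -> connected_component A y z ->
  connected_component A x = connected_component A y.
Proof.
by move=> /same_connected_component -> /same_connected_component ->.
Qed.

Lemma component_mono A B x : A `<=` B ->
  connected_component A x `<=` connected_component B x.
Proof.
move=> AB y [C [Cx CA cC] Cy]; exists C => //; split => //.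
exact: subset_trans AB.
Qed.

Lemma component_setC C x y : connected_component (~` C) x y -> ~ C y.
Proof. by move=> /connected_component_sub. Qed.

End GeneralTopology.

(** * Components of open sets *)

Section Components.
Context {X : topologicalType}.
Hypothesis X_lconn : locally_connected_space X.
Implicit Types (A B C K N O Q S U V W : set X).

Lemma open_component O x : open O -> open (connected_component O x).
Proof.
move=> oO; rewrite openE => y Exy.
have Oy := connected_component_sub Exy.
have [V [oV Vy cV VO]] : exists V, [/\ open V, V y, connected V & V `<=` O].
  by apply: X_lconn; exact: open_nbhs_nbhs.
apply: (@filterS _ _ _ V); last exact: open_nbhs_nbhs.
by rewrite (same_connected_component Exy); exact: connected_component_max.
Qed.

(** A boundary point of a component outside C would have its own component, an
    open set, meet that component. *)
Lemma closure_component C x : closed C ->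
  closure (connected_component (~` C) x) `<=` C `|` connected_component (~` C) x.
Proof.
move=> cC z clz; have [Cz|nCz] := pselect (C z); [by left|right].
have [w [Exw Ezw]] := clz _ (open_nbhs_nbhs (conj
  (@open_component (~` C) z (closed_openC cC)) (connected_component_refl nCz))).
by rewrite (component_eq_of_meet Exw Ezw); exact: connected_component_refl.
Qed.

Hypothesis X_conn : connected [set: X].

Lemma clopen_setT A : open A -> closed A -> A !=set0 -> A = setT.
Proof.
by move=> oA cA A0; apply: X_conn => //; exists A => //; rewrite setTI.
Qed.

(** Otherwise the component would be open and closed in the connected space X. *)
Lemma closure_component_meets C x : closed C -> C !=set0 -> ~ C x ->
  closure (connected_component (~` C) x) `&` C !=set0.
Proof.
move=> cC [c Cc] nCx; apply: contrapT => meetsN.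
set E := connected_component (~` C) x.
have ET : E = setT.
  apply: clopen_setT; first exact/open_component/closed_openC.
    rewrite closure_id; apply/seteqP; split; first exact: subset_closure.
    move=> z clz; have [Cz|//] := closure_component cC clz.
    by exfalso; apply: meetsN; exists z.
  by exists x; exact: connected_component_refl.
have : E c by rewrite ET.
by move=> /connected_component_sub; exact.
Qed.

(** P selects which complementary components of C, the holes, are filled in.  It
    will be: not containing a given point, lying in a given open set, or being
    bounded. *)
Definition fill (P : set X -> Prop) C :=
  C `|` [set x | ~ C x /\ P (connected_component (~` C) x)].

Lemma setC_fill P C x : ~ fill P C x ->
  [/\ ~ C x, ~ P (connected_component (~` C) x) &
    connected_component (~` C) x `<=` ~` fill P C].
Proof.
move=> nf; have nCx : ~ C x by move=> Cx; apply: nf; left.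
have nP : ~ P (connected_component (~` C) x) by move=> Px; apply: nf; right.
split => // y Exy [Cy|[_]].
  exact: component_setC Exy Cy.
by rewrite -(same_connected_component Exy).
Qed.

Lemma sub_fill P C : C `<=` fill P C. Proof. by move=> x; left. Qed.

Lemma closed_fill P C : closed C -> closed (fill P C).
Proof.
move=> cC; rewrite -openC openE => x /setC_fill[nCx _ sub].
apply: filterS sub _; apply: open_nbhs_nbhs; split.
  exact/open_component/closed_openC.
exact: connected_component_refl.
Qed.

(** Each filled component adheres to C. *)
Lemma connected_fill P C : closed C -> C !=set0 -> connected C ->
  connected (fill P C).
Proof.
move=> cC C0 conC; apply: (connected_star conC (@sub_fill P C)) => x.
move=> [Cx|[nCx Px]].
  exists C; split => //; first exact: sub_fill.
  by exists x.
exists (closure (connected_component (~` C) x)); split.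
- exact/subset_closure/connected_component_refl.
- move=> y /(closure_component cC)[Cy|Exy]; first by left.
  right; split; first exact: component_setC Exy.
  by rewrite -(same_connected_component Exy).
- exact/connected_closure/component_connected.
- exact: closure_component_meets.
Qed.

(** The complement of one component is C with all the other ones filled in. *)
Lemma connected_setC_component C x : closed C -> C !=set0 -> connected C ->
  ~ C x -> connected (~` connected_component (~` C) x).
Proof.
move=> cC C0 conC nCx.
suff -> : ~` connected_component (~` C) x = fill (fun E => ~ E x) C.
  exact: connected_fill.
apply/seteqP; split => y.
  move=> nE; have [Cy|nCy] := pselect (C y); [by left|right; split => //].
  by move=> Eyx; apply: nE; exact: connected_component_sym.
move=> [Cy Exy|[_ nE] Exy]; first exact: component_setC Exy Cy.
by apply: nE; exact: connected_component_sym.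
Qed.

(** * Connecting compact sets inside open sets *)

Hypothesis X_haus : hausdorff_space X.
Hypothesis X_lcomp : locally_compact [set: X].

Lemma bounded_of_sub_compact A B : A `<=` B -> compact B -> has_compact_closure A.
Proof.
move=> AB cB; apply: (subclosed_compact _ cB); first exact: closed_closure.
by rewrite (closure_id B).1; [exact: closureS|exact: compact_closed].
Qed.

Lemma connected_bounded_nbhs O x : open O -> O x ->
  exists N, [/\ open N, N x, connected N, compact (closure N) & closure N `<=` O].
Proof.
move=> oO Ox; have [L] := X_lcomp (I : setT x); rewrite withinET => nL [cL clL].
have [U nU UO] := compact_regular X_haus cL nL (open_nbhs_nbhs (conj oO Ox)).
have [N [oN Nx cN NUL]] := X_lconn (filterI nU nL).
exists N; split => //.
  by apply: (@bounded_of_sub_compact N L) => // y /NUL[].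
by apply: subset_trans UO; apply: closureS => y /NUL[].
Qed.

Lemma compact_open_between K U : compact K -> open U -> K `<=` U ->
  exists W, [/\ open W, K `<=` W, W `<=` U & has_compact_closure W].
Proof.
move=> cK oU KU; pose P A :=
  exists W, [/\ open W, A `<=` W, W `<=` U & has_compact_closure W].
apply: (@compact_local_ind _ P) cK _.
- exists set0; split => //; first exact: open0.
  by rewrite /has_compact_closure closure0; exact: compact0.
- move=> A B [V [oV AV VU cV]] [W [oW BW WU cW]].
  exists (V `|` W); split; [exact: openU|exact: setUSS|by rewrite subUset|].
  by rewrite /has_compact_closure closureU; exact: compactU.
- move=> A B AB [W [oW BW WU cW]]; exists W; split => //.
  exact: subset_trans BW.
- move=> x /KU Ux; have [N [oN Nx _ cN NU]] := connected_bounded_nbhs oU Ux.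
  exists N; first exact: open_nbhs_nbhs.
  by exists N; split => //; exact: subset_trans (@subset_closure _ N) NU.
Qed.

(** The points that a compact connected subset of O joins to x form a subset of
    the component of x that is relatively open and closed, because each point of
    O has a connected neighbourhood with compact closure inside O. *)
Lemma join_in_component O x y : open O -> connected_component O x y ->
  exists C, [/\ compact C, connected C, C `<=` O, C x & C y].
Proof.
move=> oO Exy; pose J := [set z | exists C, [/\ compact C, connected C, C `<=` O, C x & C z]].
have step z w N : J z -> connected N -> compact (closure N) ->
    closure N `<=` O -> N z -> N w -> J w.
  move=> [C [cC conC CO Cx Cz]] conN cN NO Nz Nw.
  exists (C `|` closure N); split.
  - exact: compactU.
  - apply: connectedU => //; last exact: connected_closure.
    by exists z; split => //; exact: subset_closure.
  - by rewrite subUset.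
  - by left.
  - by right; exact: subset_closure.
have JE : J `<=` connected_component O x.
  by move=> z [C [_ conC CO Cx Cz]]; exists C.
have Ox := connected_component_sub (connected_component_sym Exy).
suff JEq : J = connected_component O x by rewrite -JEq in Exy.
apply: component_connected.
- exists x; exists [set x]; split => //; [exact: compact_set1|exact: connected1|].
  by move=> _ ->.
- exists J; last by rewrite setIidr.
  rewrite openE => z Jz; have Oz := connected_component_sub (JE z Jz).
  have [N [oN Nz conN cN NO]] := connected_bounded_nbhs oO Oz.
  apply: (@filterS _ _ _ N); last exact: open_nbhs_nbhs.
  by move=> w; exact: step Jz _ _ _ _.
- exists (closure J); first exact: closed_closure.
  apply/seteqP; split=> z; first by move=> Jz; split; [exact: JE|exact: subset_closure].
  move=> [Ez clz]; have Oz := connected_component_sub Ez.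
  have [N [oN Nz conN cN NO]] := connected_bounded_nbhs oO Oz.
  have [w [Jw Nw]] := clz N (open_nbhs_nbhs (conj oN Nz)).
  exact: step Jw conN cN NO Nw Nz.
Qed.

(** The compact sets covering Q piece by piece must match up inside each component
    of O.  So each component gets a base point b, and every piece added along the
    induction is joined to the base point of its component. *)
Lemma compact_connected_traces Q O : compact Q -> open O -> Q `<=` O ->
  exists F, [/\ compact F, Q `<=` F, F `<=` O &
    forall x, connected (F `&` connected_component O x)].
Proof.
move=> cQ oO QO; have [Q0|/set0P[q Qq]] := eqVneq Q set0.
  exists set0; split=> //; [exact: compact0|by rewrite Q0|].
  by move=> x; rewrite set0I; exact: connected0.
pose b x := xget q (connected_component O x).
have bE x y : connected_component O x y -> b x = b y.
  by rewrite /b => /same_connected_component ->.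
have Eb x : O x -> connected_component O x (b x).
  by move=> Ox; apply: xgetPex; exists x; exact: connected_component_refl.
pose P A := exists F, [/\ compact F, A `<=` F, F `<=` O &
  forall y, F y -> connected_component F y (b y)].
suff [F [cF QF FO Fb]] : P Q.
  exists F; split => // x.
  have [->|/set0P[y [Fy Exy]]] := eqVneq (F `&` connected_component O x) set0.
    exact: connected0.
  suff -> : F `&` connected_component O x = connected_component F y.
    exact: component_connected.
  apply/seteqP; split=> [z [Fz Exz]|z Fyz].
    apply: (@connected_component_trans _ _ (b y)); first exact: Fb.
    apply: connected_component_sym; rewrite -(bE _ _ Exy) (bE _ _ Exz).
    exact: Fb.
  split; first exact: connected_component_sub Fyz.
  exact: connected_component_trans Exy (component_mono FO Fyz).
apply: (@compact_local_ind _ P) cQ _.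
- by exists set0; split => //; exact: compact0.
- move=> A B [F [cF AF FO Fb]] [G [cG BG GO Gb]]; exists (F `|` G); split.
  + exact: compactU.
  + exact: setUSS.
  + by rewrite subUset.
  + move=> y [/Fb|/Gb]; apply: component_mono; [exact: subsetUl|exact: subsetUr].
- move=> A B AB [F [cF BF FO Fb]]; exists F; split => //.
  exact: subset_trans BF.
- move=> x /QO Ox; have [N [oN Nx conN cN NO]] := connected_bounded_nbhs oO Ox.
  have [C [cC conC CO Cx Cb]] := join_in_component oO (Eb x Ox).
  exists N; first exact: open_nbhs_nbhs.
  have conF : connected (closure N `|` C).
    apply: connectedU => //; last exact: connected_closure.
    by exists x; split => //; exact: subset_closure.
  have FO : closure N `|` C `<=` O by rewrite subUset.
  exists (closure N `|` C); split => //.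
  + exact: compactU.
  + by apply: subset_trans (@subset_closure _ N) _; exact: subsetUl.
  + move=> y Fy; exists (closure N `|` C); first by split.
    have Exy : connected_component O x y.
      exists (closure N `|` C) => //; split => //.
      by left; exact: subset_closure.
    by rewrite -(bE _ _ Exy); right.
Qed.

(** * Interpolation by solid sets *)

Lemma solid_set0 : solid (@set0 X).
Proof.
split; [exact: connected0|move=> nc x _|by move=> _; rewrite setC0].
rewrite setC0 connected_component_id // /has_compact_closure closureT.
exact: nc.
Qed.

(** A compact connected C between K and U exists by the connecting lemma.  Filling
    in the complementary components of C that lie in U gives the solid set: every
    other one contains a component of the complement of U, hence is unbounded, or
    contains the whole complement of U when X is compact. *)
Lemma compact_solid_between K U : compact K -> bounded_open_solid U ->
  K `<=` U -> exists C, [/\ compact_solid C, K `<=` C & C `<=` U].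
Proof.
move=> cK [oU bU [conU ncU cU]] KU.
have [K0|/set0P[k Kk]] := eqVneq K set0.
  exists set0; rewrite K0; split => //; split; first exact: compact0.
  exact: solid_set0.
have [C [cC KC CU conC]] := compact_connected_traces cK oU KU.
have {}conC : connected C.
  have := conC k; rewrite connected_component_id //; last exact: KU.
  by rewrite setIidl.
have clC : closed C by exact: compact_closed.
have C0 : C !=set0 by exists k; exact: KC.
pose S := fill (fun E => E `<=` U) C.
have SU : S `<=` U.
  move=> x [/CU//|[nCx]]; apply; exact: connected_component_refl.
have clS : closed S by exact: closed_fill.
have outside x : ~ S x -> exists y, [/\ ~ U y, connected_component (~` C) x `<=` ~` S &
    connected_component (~` U) y `<=` connected_component (~` C) x].
  move=> /setC_fill[nCx /existsNP[y /not_implyP[Exy nUy]] ES].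
  exists y; split => //; rewrite (same_connected_component Exy).
  by apply: component_mono; exact: subsetC.
exists S; split => //; last exact: subset_trans (@sub_fill _ _).
split.
  apply: (subclosed_compact clS bU).
  by apply: subset_trans SU _; exact: subset_closure.
split; first exact: connected_fill.
- move=> nc x nSx; have [y [nUy ES sub]] := outside x nSx.
  move=> bE; apply: (ncU nc y nUy); apply: (bounded_of_sub_compact _ bE).
  apply: subset_trans sub _; apply: subset_trans (@subset_closure _ _).
  apply: connected_component_max => //; last exact: component_connected.
  by apply: connected_component_refl; case: (setC_fill nSx).
- move=> cT; apply: (connected_star (cU cT)); first exact: subsetC.
  move=> x nSx; have [y [nUy ES sub]] := outside x nSx.
  exists (connected_component (~` C) x); split => //.
  + by apply: connected_component_refl; case: (setC_fill nSx).
  + exact: component_connected.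
  + by exists y; split => //; apply: sub; exact: connected_component_refl.
Qed.

(** Take a bounded open W between K and U and a compact set F around its boundary,
    disjoint from K and with connected traces on the components D of the
    complement of K.  The component V of the complement of F that contains K
    cannot cross the boundary of W.  Any other component of the complement of F
    avoids K, hence lies in some D, and adheres to F there; so D minus V is
    connected.  These sets D minus V make up the complement of V.  If X is not
    compact, they are unbounded because the D are unbounded and V is bounded; if X
    is compact, there is only one D, the complement of K. *)
Lemma open_solid_between K U : compact_solid K -> open U ->
  K `<=` U -> exists V, [/\ bounded_open_solid V, K `<=` V & V `<=` U].
Proof.
move=> [cK [conK ncK ccK]] oU KU.
have [K0|/set0P[k Kk]] := eqVneq K set0.
  exists set0; rewrite K0; split => //; split; [exact: open0| |exact: solid_set0].
  by rewrite /has_compact_closure closure0; exact: compact0.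
have clK : closed K by exact: compact_closed.
have [W [oW KW WU bW]] := compact_open_between cK oU KU.
have cdW : compact (closure W `\` W).
  by apply: compact_closedI => //; exact: open_closedC.
have dWK : closure W `\` W `<=` ~` K by move=> x [_ nWx] /KW.
have [F [cF dWF FK conF]] := compact_connected_traces cdW (closed_openC clK) dWK.
have clF : closed F by exact: compact_closed.
have KF : K `<=` ~` F by move=> x Kx /FK.
pose V := connected_component (~` F) k.
have oV : open V by exact/open_component/closed_openC.
have KV : K `<=` V by exact: connected_component_max.
have VF x : V x -> ~ F x by exact: component_setC.
have VW : V `<=` W.
  have VdW : V `&` (closure W `\` W) = set0.
    by apply/disjoints_subset => x /VF nFx /dWF.
  have [//|VnW] := connected_avoiding_boundary oW (@component_connected _ _ _) VdW.
  by exfalso; apply: (VnW k); [exact: KV|exact/subset_closure/KW].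
pose D x := connected_component (~` K) x.
have conDV x : connected (D x `\` V).
  apply: (connected_star (conF x)).
    by move=> y [Fy Dy]; split => // /VF.
  move=> y [Dxy nVy].
  have [Fy|nFy] := pselect (F y).
    exists [set y]; split => //; [by move=> _ ->|exact: connected1|by exists y].
  set E := connected_component (~` F) y.
  have EV z : E z -> ~ V z.
    move=> Ez Vz; apply: nVy; rewrite /V -(component_eq_of_meet Ez Vz).
    exact: connected_component_refl.
  have clEV z : closure E z -> ~ V z.
    by move=> clz Vz; have [w [/EV]] := clz _ (open_nbhs_nbhs (conj oV Vz)).
  have Ey : closure E y by exact/subset_closure/connected_component_refl.
  have conE : connected (closure E) by exact/connected_closure/component_connected.
  have clED : closure E `<=` D x.
    rewrite /D (same_connected_component Dxy).
    by apply: connected_component_max => // z /clEV nVz /KV.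
  exists (closure E); split => //; first by move=> z clz; split; [exact: clED|exact: clEV].
  have F0 : F !=set0.
    apply/set0P/eqP => F0; apply: nVy.
    by rewrite /V F0 setC0 connected_component_id.
  have [z [clz Fz]] := closure_component_meets clF F0 nFy.
  by exists z; split => //; split => //; exact: clED.
exists V; split => //; last exact: subset_trans WU.
have bV : has_compact_closure V.
  by apply: (bounded_of_sub_compact _ bW); exact: subset_trans (@subset_closure _ W).
split => //; split; first exact: component_connected.
- move=> nc x nVx bE; have nKx : ~ K x by move=> /KV.
  apply: (ncK nc x nKx); apply: (bounded_of_sub_compact _ (compactU bE bV)).
  move=> y Dy; have [Vy|nVy] := pselect (V y); [right|left]; apply: subset_closure => //.
  exists (D x `\` V) => //; split=> [|z []//|]; last exact: conDV.
  by split => //; exact: connected_component_refl.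
- move=> cT; have [T0|/set0P[x nVx]] := eqVneq (~` V) set0.
    by rewrite T0; exact: connected0.
  suff -> : ~` V = D x `\` V by [].
  have nKx : (~` K) x by move=> /KV.
  rewrite /D connected_component_id //; last exact: ccK.
  by apply/seteqP; split=> y; [split => // /KV|case].
Qed.

(** * The solid hull of a compact connected set *)

Definition solid_hull C := fill has_compact_closure C.

(** The hull is bounded although C may have infinitely many holes.  Let W be a
    bounded open neighbourhood of C.  A hole that misses the boundary of W lies
    in W, since it adheres to C.  The compact boundary of W meets only finitely
    many holes; the local induction, which collects a compact set containing all
    the bounded holes met so far, expresses this without enumerating them. *)
Lemma compact_solid_hull C : compact C -> connected C -> C !=set0 ->
  compact (solid_hull C).
Proof.
move=> cC conC C0; have clC : closed C by exact: compact_closed.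
have [W [oW CW _ bW]] := compact_open_between cC openT (@subsetT _ C).
have cdW : compact (closure W `\` W).
  by apply: compact_closedI => //; exact: open_closedC.
pose E x := connected_component (~` C) x.
pose P A := exists2 L, compact L &
  forall x, A x -> ~ C x -> has_compact_closure (E x) -> E x `<=` L.
have [L cL EL] : P (closure W `\` W).
  apply: (@compact_local_ind _ P) cdW _.
  - by exists set0; first exact: compact0.
  - move=> A B [L cL AL] [M cM BM]; exists (L `|` M); first exact: compactU.
    move=> x [Ax|Bx] nCx bE; first exact: subset_trans (AL x Ax nCx bE) _.
    exact: subset_trans (BM x Bx nCx bE) _.
  - by move=> A B AB [L cL BL]; exists L => // x /AB; exact: BL.
  - move=> x [_ nWx]; have nCx : ~ C x by move=> /CW.
    exists (E x).
      apply: open_nbhs_nbhs; split; first exact/open_component/closed_openC.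
      exact: connected_component_refl.
    have [bE|nbE] := pselect (has_compact_closure (E x)).
      exists (closure (E x)) => // y Exy _ _.
      by rewrite /E -(same_connected_component Exy); exact: subset_closure.
    exists set0; first exact: compact0.
    by move=> y Exy _; rewrite /E -(same_connected_component Exy).
apply: (subclosed_compact (closed_fill clC) (compactU bW cL)).
move=> x [/CW Wx|[nCx bE]]; first by left; exact: subset_closure.
have Exx : E x x by exact: connected_component_refl.
have [EdW|/set0P[y [Exy dWy]]] := eqVneq (E x `&` (closure W `\` W)) set0.
  have [EW|EW] := connected_avoiding_boundary oW (@component_connected _ _ _) EdW.
    by left; exact/subset_closure/EW.
  have [z [clz Cz]] := closure_component_meets clC C0 nCx.
  have [w [/EW nclw Ww]] := clz _ (open_nbhs_nbhs (conj oW (CW _ Cz))).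
  by exfalso; exact/nclw/subset_closure.
right; have Eeq : E x = E y by exact: same_connected_component.
by move: Exx; rewrite Eeq; apply: EL => //; [exact: component_setC Exy|rewrite -Eeq].
Qed.

Lemma compact_solid_of_hull C : compact C -> connected C -> C !=set0 ->
  compact_solid (solid_hull C).
Proof.
move=> cC conC C0; have clC : closed C by exact: compact_closed.
split; first exact: compact_solid_hull.
split; first exact: connected_fill.
- move=> nc x nHx bE; have [nCx nbE sub] := setC_fill nHx.
  apply: nbE; apply: (bounded_of_sub_compact _ bE).
  apply: subset_trans (@subset_closure _ _).
  apply: connected_component_max => //; last exact: component_connected.
  exact: connected_component_refl.
- move=> cT; suff -> : ~` solid_hull C = set0 by exact: connected0.
  apply/seteqP; split => // x /setC_fill[_ nb _]; apply: nb.
  exact: bounded_of_sub_compact cT.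
Qed.

Lemma bounded_open_solid_component C x : compact C -> connected C -> ~ C x ->
  C !=set0 ->
  has_compact_closure (connected_component (~` C) x) ->
  bounded_open_solid (connected_component (~` C) x).
Proof.
move=> cC conC nCx C0 bE; have clC : closed C by exact: compact_closed.
have conE := connected_setC_component clC C0 conC nCx.
split => //; first exact/open_component/closed_openC.
split => //; first exact: component_connected.
move=> nc y nEy; rewrite connected_component_id // => bnE; apply: nc.
apply: (subclosed_compact closedT (compactU bE bnE)) => z _.
have [Ez|nEz] := pselect (connected_component (~` C) x z); [left|right];
  exact: subset_closure.
Qed.

End Components.

(** * Topological measures *)

Section TopologicalMeasures.
Context {R : realType} {X : topologicalType}.
Local Open Scope ereal_scope.
Implicit Types (A B C D K O Q S U V W : set X) (mu nu : set X -> \bar R).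

Lemma tm_le mu A B : topological_measure mu ->
  closed A \/ open A -> closed B \/ open B -> A `<=` B -> mu A <= mu B.
Proof.
move=> tm.
have le_open U V : open U -> open V -> U `<=` V -> mu U <= mu V.
  move=> oU oV UV; rewrite (tm_inner tm oU) (tm_inner tm oV).
  apply: ereal_sup_le => _ [K [cK KU] <-]; exists K => //; split => //.
  exact: subset_trans UV.
have le_closed_open F V : closed F -> open V -> F `<=` V -> mu F <= mu V.
  move=> cF oV FV; rewrite (tm_outer tm cF).
  by apply: ereal_inf_lbound; exists V.
move=> [cA|oA] [cB|oB] AB; [|exact: le_closed_open| |exact: le_open].
- rewrite (tm_outer tm cB); apply: le_ereal_inf_tmp => _ [V [oV BV] <-].
  by apply: le_closed_open => //; exact: subset_trans BV.
- rewrite (tm_outer tm cB); apply: le_ereal_inf_tmp => _ [V [oV BV] <-].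
  by apply: le_open => //; exact: subset_trans BV.
Qed.

Lemma tm_set0 mu : topological_measure mu -> compact_finite mu -> mu set0 = 0.
Proof.
move=> tm fin; have co0 : compact (@set0 X) \/ open (@set0 X).
  by left; exact: compact0.
have mu0 : mu set0 \is a fin_num.
  rewrite ge0_fin_numE; first exact/fin/compact0.
  by apply: (tm_ge0 tm); left; exact: closed0.
have := tm_additive tm co0 co0; rewrite setU0 => /(_ co0 (setI0 _)) mu00.
by rewrite -[LHS](addeK (mu set0) mu0) -mu00 subee.
Qed.

(** Z is either the family of compact sets or that of open sets: additivity is
    only available when all the partial unions are compact or open, and Z
    guarantees this by being stable under unions. *)
Lemma tm_bigcup mu (Z : set X -> Prop) (I : choiceType) (s : seq I) (A : I -> set X) :
  topological_measure mu -> compact_finite mu ->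
  (forall B, Z B -> compact B \/ open B) -> Z set0 ->
  (forall B C, Z B -> Z C -> Z (B `|` C)) ->
  uniq s -> (forall i, i \in s -> Z (A i)) -> trivIset [set` s] A ->
  Z (\bigcup_(i in [set` s]) A i) /\
  mu (\bigcup_(i in [set` s]) A i) = \sum_(i <- s) mu (A i).
Proof.
move=> tm fin Zco Z0 ZU; elim: s => [|i s IH] /=.
  by move=> _ _ _; rewrite set_nil bigcup_set0 big_nil (tm_set0 tm fin).
move=> /andP[nis us] ZA tA.
have Zi : Z (A i) by apply: ZA; rewrite mem_head.
have [] := IH us.
- by move=> j js; apply: ZA; rewrite in_cons js orbT.
- by apply: sub_trivIset tA => j /= js; rewrite in_cons js orbT.
rewrite !bigcup_seq => Zs mus; rewrite !big_cons -mus.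
have ZUs := ZU _ _ Zi Zs; split => //.
apply: (tm_additive tm); [exact: Zco..|].
rewrite -bigcup_seq; apply/disjoints_subset => x Aix [j /= js Ajx].
have ij : i = j.
  by apply: tA; rewrite /= ?mem_head// ?in_cons ?js ?orbT//; exists x.
by rewrite ij js in nis.
Qed.

End TopologicalMeasures.

(** * Restriction to solid sets and uniqueness *)

Section Comparison.
Context {R : realType} {X : topologicalType}.
Hypothesis X_haus : hausdorff_space X.
Hypothesis X_lcomp : locally_compact [set: X].
Hypothesis X_conn : connected [set: X].
Hypothesis X_lconn : locally_connected_space X.
Local Open Scope ereal_scope.
Implicit Types (A B C D K O Q S U V W : set X) (mu nu : set X -> \bar R).

Lemma bounded_solid_compact_open A : bounded_solid A -> compact A \/ open A.
Proof. by case=> [[]|[]]; [left|right]. Qed.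

Lemma compact_open_closed_open A : compact A \/ open A -> closed A \/ open A.
Proof. by case=> [/(compact_closed X_haus)|]; [left|right]. Qed.

Lemma tm_solid_set_function mu : topological_measure mu -> compact_finite mu ->
  solid_set_function mu.
Proof.
move=> tm fin; have co A := @bounded_solid_compact_open A.
have clo A := @compact_open_closed_open A.
split.
- by move=> A /co/clo; exact: (tm_ge0 tm).
- move=> A bA; have [[cA _]|[oA bdA _]] := bA; first exact: fin.
  apply: le_lt_trans (fin _ bdA); apply: (tm_le tm); first by right.
    by left; exact: closed_closure.
  exact: subset_closure.
- move=> n Ci C sCi sC tCi CiC.
  have [] := @tm_bigcup R X mu compact _ (index_enum 'I_n) Ci tm fin.
  + by move=> B cB; left.
  + exact: compact0.
  + by move=> B D; exact: compactU.
  + exact: index_enum_uniq.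
  + by move=> i _; case: (sCi i).
  + by move=> i j _ _; exact: tCi.
  move=> cU <-; apply: (tm_le tm); [exact/clo/or_introl|by apply: clo; left; case: sC|].
  by move=> x [i _ Cix]; apply: CiC; exists i.
- move=> U sU; have [oU bU _] := sU; apply/eqP; rewrite eq_le; apply/andP; split.
    rewrite (tm_inner tm oU); apply: ge_ereal_sup => _ [K [cK KU] <-].
    have [C [sC KC CU]] := compact_solid_between X_lconn X_conn X_haus X_lcomp cK sU KU.
    apply: le_trans (ereal_sup_ubound _); last by exists C.
    by apply: (tm_le tm) => //; apply: clo; left => //; case: sC.
  apply: ge_ereal_sup => _ [K [[cK _] KU] <-].
  by apply: (tm_le tm) => //; [apply: clo; left|right].
- move=> K sK; have [cK _] := sK; have clK := compact_closed X_haus cK.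
  apply/eqP; rewrite eq_le; apply/andP; split.
    apply: le_ereal_inf_tmp => _ [U [[oU _ _] KU] <-].
    by apply: (tm_le tm) => //; [left|right].
  rewrite [leRHS](tm_outer tm clK); apply: le_ereal_inf_tmp => _ [U [oU KU] <-].
  have [V [sV KV VU]] := open_solid_between X_lconn X_conn X_haus X_lcomp sK oU KU.
  apply: le_trans (ereal_inf_lbound _) _; first by exists V.
  by apply: (tm_le tm) => //; right => //; case: sV.
- move=> n A B sA sB tA BE.
  (* A piece that is both compact and open is counted among the compact ones. *)
  pose c i := `[< compact (A i) >].
  pose s1 := [seq i <- index_enum 'I_n | c i].
  pose s2 := [seq i <- index_enum 'I_n | ~~ c i].
  have [] := @tm_bigcup R X mu compact _ s1 A tm fin.
  + by move=> C cC; left.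
  + exact: compact0.
  + by move=> C D; exact: compactU.
  + exact/filter_uniq/index_enum_uniq.
  + by move=> i; rewrite mem_filter => /andP[/asboolP].
  + by move=> i j _ _; exact: tA.
  move=> cU1 mu1.
  have [] := @tm_bigcup R X mu open _ s2 A tm fin.
  + by move=> C cC; right.
  + exact: open0.
  + by move=> C D; exact: openU.
  + exact/filter_uniq/index_enum_uniq.
  + move=> i; rewrite mem_filter => /andP[/asboolPn nc _].
    by have [] := co _ (sA i).
  + by move=> i j _ _; exact: tA.
  move=> oU2 mu2.
  have BE12 : B = \bigcup_(i in [set` s1]) A i `|` \bigcup_(i in [set` s2]) A i.
    rewrite BE -bigcup_setU; congr bigcup; apply/seteqP; split => // i _ /=.
    by rewrite !mem_filter mem_index_enum !andbT; case: (c i); [left|right].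
  rewrite (bigID c) /= -[X in X + _]big_filter -[X in _ + X]big_filter.
  rewrite -mu1 -mu2 BE12.
  apply: (tm_additive tm); [by left|by right|by rewrite -BE12; exact: co|].
  apply/disjoints_subset => x [i /=]; rewrite mem_filter => /andP[ci _] Aix.
  move=> [j /=]; rewrite mem_filter => /andP[ncj _] Ajx.
  by move: ncj; rewrite -(tA i j) ?ci //; exists x.
Qed.

(** A compact subset K of U lies in a finite union V of components of U, where the
    inequality follows by additivity.  To run the local induction on K, V ranges
    over the saturated sets, those that are unions of components; and the
    inequality is required for all saturated subsets of V, since the union of V
    and W is cut into V and a saturated part of W. *)
Lemma tm_le_open_of_components mu nu U :
  topological_measure mu -> topological_measure nu ->
  mu set0 <= nu set0 -> open U ->
  (forall x, U x -> mu (connected_component U x) <= nu (connected_component U x)) ->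
  mu U <= nu U.
Proof.
move=> tm tn le0 oU leE; pose E x := connected_component U x.
pose sat V := V `<=` U /\ forall x, V x -> E x `<=` V.
have sat_open V : sat V -> open V.
  move=> [VU EV]; rewrite openE => x Vx; apply: filterS (EV x Vx) _.
  apply: open_nbhs_nbhs; split; first exact: open_component.
  exact/connected_component_refl/VU.
pose P A := exists V, [/\ sat V, A `<=` V &
  forall V', sat V' -> V' `<=` V -> mu V' <= nu V'].
rewrite (tm_inner tm oU); apply: ge_ereal_sup => _ [K [cK KU] <-].
suff [V [sV KV leV]] : P K.
  have oV := sat_open V sV.
  apply: (@le_trans _ _ (mu V)).
    apply: (tm_le tm) => //; last by right.
    by left; exact: compact_closed.
  apply: (le_trans (leV V sV (@subset_refl _ V))).
  by apply: (tm_le tn); [right|right|case: sV].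
apply: (@compact_local_ind _ P) cK _.
- exists set0; split => //; first by split.
  by move=> V' _; rewrite subset0 => ->.
- move=> A B [V [sV AV leV]] [W [sW BW leW]]; exists (V `|` W); split.
  + split; first by rewrite subUset; split; [case: sV|case: sW].
    by move=> x [/sV.2|/sW.2] EVx; apply: subset_trans EVx _.
  + exact: setUSS.
  + move=> V' sV' V'VW.
    have s1 : sat (V' `&` V).
      split; first by move=> x [_ /sV.1].
      by move=> x [/sV'.2 EV' /sV.2 EV] y Exy; split; [exact: EV'|exact: EV].
    have s2 : sat (V' `\` V).
      split; first by move=> x [/sV'.1].
      move=> x [V'x nVx] y Exy; split; first exact: sV'.2 Exy.
      by move=> /sV.2 EV; apply/nVx/EV; exact: connected_component_sym.
    have split12 mu' : topological_measure mu' -> mu' V' = mu' (V' `&` V) + mu' (V' `\` V).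
      move=> tm'; rewrite -{1}(setUIDK V' V); apply: (tm_additive tm').
      + by right; exact: sat_open.
      + by right; exact: sat_open.
      + by right; rewrite setUIDK; exact: sat_open.
      + by apply/seteqP; split => // x [[_ Vx] [_]].
    rewrite !split12 //; apply: leeD; first by apply: leV => // x [].
    by apply: leW => // x [/V'VW []].
- move=> A B AB [V [sV BV leV]]; exists V; split => //; exact: subset_trans BV.
- move=> x /KU Ux; exists (E x).
    apply: open_nbhs_nbhs; split; first exact: open_component.
    exact: connected_component_refl.
  exists (E x); split => //.
    split; first exact: connected_component_sub.
    by move=> y Exy; rewrite /E (same_connected_component Exy).
  move=> V' [_ sV'] V'E; have [->//|/set0P[y V'y]] := eqVneq V' set0.
  suff -> : V' = E x by exact: leE.
  apply/seteqP; split => //.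
  by rewrite /E (same_connected_component (V'E y V'y)); exact: sV'.
Qed.

(** C is the solid hull minus the union B of the holes; both measures agree on the
    hull, and on B because they agree on each hole, and B has finite measure. *)
Lemma tm_eq_compact_connected mu nu C :
  topological_measure mu -> compact_finite mu ->
  topological_measure nu -> compact_finite nu ->
  (forall A, bounded_solid A -> nu A = mu A) ->
  compact C -> connected C -> nu C = mu C.
Proof.
move=> tm fm tn fn eqs cC conC.
have [->|/set0P C0] := eqVneq C set0; first by rewrite !tm_set0.
have clC := compact_closed X_haus cC.
pose H := solid_hull C; pose B := H `\` C.
have sH : compact_solid H by exact: compact_solid_of_hull.
have BE x : B x -> ~ C x /\ has_compact_closure (connected_component (~` C) x).
  by move=> [[//|]].
have EB x : B x -> connected_component (~` C) x `<=` B.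
  move=> /BE[nCx bE] y Exy; have nCy := component_setC Exy.
  split => //; right; split => //.
  by rewrite -(same_connected_component Exy).
have oB : open B.
  rewrite openE => x Bx; apply: filterS (EB x Bx) _; apply: open_nbhs_nbhs.
  split; first exact/open_component/closed_openC.
  by apply: connected_component_refl; case: (BE x Bx).
have compB x : B x -> connected_component B x = connected_component (~` C) x.
  move=> Bx; apply/seteqP; split.
    by apply: component_mono => y [].
  apply: connected_component_max; last exact: component_connected.
    by apply: connected_component_refl; case: (BE x Bx).
  exact: EB.
have solB x : B x -> nu (connected_component B x) = mu (connected_component B x).
  move=> Bx; have [nCx bE] := BE x Bx; rewrite compB //; apply: eqs; right.
  exact: bounded_open_solid_component.
have eq0 : nu set0 = mu set0 by rewrite !tm_set0.
have eqB : nu B = mu B.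
  apply/eqP; rewrite eq_le; apply/andP; split; apply: tm_le_open_of_components => //;
    by [rewrite eq0|move=> x Bx; rewrite solB].
have split_hull mu' : topological_measure mu' -> mu' H = mu' C + mu' B.
  move=> tm'; have HE : C `|` B = H by rewrite setDUK //; exact: sub_fill.
  rewrite -HE; apply: (tm_additive tm'); [by left|by right| |].
    by left; rewrite HE; case: sH.
  by apply/seteqP; split => // x [Cx []].
have finB : mu B \is a fin_num.
  rewrite ge0_fin_numE; last by apply: (tm_ge0 tm); right.
  apply: le_lt_trans (fm H sH.1); apply: (tm_le tm); first by right.
    by left; apply: (compact_closed X_haus); case: sH.
  by move=> x [].
rewrite -[LHS](addeK _ finB) -[RHS](addeK _ finB) -{1}eqB -!split_hull //.
by rewrite eqs //; left.
Qed.

(** By components, U may be taken connected; then each compact K in U lies in a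
    compact connected subset F of U. *)
Lemma tm_le_open_of_eq_compact_connected mu nu U :
  topological_measure mu -> compact_finite mu ->
  topological_measure nu -> compact_finite nu ->
  (forall C, compact C -> connected C -> nu C = mu C) ->
  open U -> nu U <= mu U.
Proof.
move=> tm fm tn fn eqC oU; apply: tm_le_open_of_components => //; first by rewrite !tm_set0.
move=> x Ux; set D := connected_component U x.
have oD : open D by exact: open_component.
have conD : connected D by exact: component_connected.
rewrite (tm_inner tn oD); apply: ge_ereal_sup => _ [K [cK KD] <-].
have [F [cF KF FD conF]] := compact_connected_traces X_lconn X_haus X_lcomp cK oD KD.
have {}conF : connected F.
  have := conF x; rewrite connected_component_id //.
    by rewrite setIidl.
  exact: connected_component_refl.
apply: (@le_trans _ _ (nu F)).
  by apply: (tm_le tn) => //; left; exact: compact_closed.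
by rewrite eqC //; apply: (tm_le tm) => //; [left; exact: compact_closed|right].
Qed.

End Comparison.

Theorem theorem10p10 (R : realType) (X : topologicalType)
    (X_hausdorff : hausdorff_space X)
    (X_locally_compact : locally_compact [set: X])
    (X_connected : connected [set: X])
    (X_locally_connected : locally_connected_space X)
    (mu : set X -> \bar R)
    (mu_tm : topological_measure mu) (mu_fin : compact_finite mu) :
  solid_set_function mu /\
  (forall nu : set X -> \bar R, topological_measure nu -> compact_finite nu ->
    (forall A : set X, bounded_solid A -> nu A = mu A) ->
    forall A : set X, closed A \/ open A -> nu A = mu A).
Proof.
split; first exact: tm_solid_set_function.
move=> nu nu_tm nu_fin eqs.
have eqC C : compact C -> connected C -> nu C = mu C.
  exact: tm_eq_compact_connected.
have eqU U : open U -> nu U = mu U.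
  move=> oU; apply/eqP; rewrite eq_le; apply/andP; split.
    exact: tm_le_open_of_eq_compact_connected.
  by apply: tm_le_open_of_eq_compact_connected => // C cC conC; rewrite eqC.
move=> A [cA|]; last exact: eqU.
rewrite (tm_outer nu_tm cA) (tm_outer mu_tm cA); congr ereal_inf.
by apply/seteqP; split => _ [U [oU AU] <-]; exists U => //; rewrite eqU.
Qed.
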